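(* Let $\sigma_1,\sigma_2,\sigma_3,\sigma_4\in\mathbb{H}$ be four quaternions with $|\sigma_m|=1$ for $m=1,\dots,4$. Then there exists a matrix $A\in Sp(2)$ such that each of $\sigma_1,\sigma_2,\sigma_3,\sigma_4$ is a left eigenvalue of $A$.
   Context: $\mathbb{H}$ denotes the real quaternions, with norm $|\cdot|$. $Sp(2)$ is the Lie group of $2\times 2$ symplectic matrices, that is, $2\times 2$ quaternionic matrices $A$ such that $AA^*=I$, where $A^*=\bar A^t$ is the conjugate transpose. A quaternion $\sigma$ is a left eigenvalue of a $2\times 2$ quaternionic matrix $A$ if there exists a vector $v\in\mathbb{H}^2$, $v\neq 0$, such that $Av=\sigma v$ (where $\sigma$ multiplies each coordinate of $v$ on the left); equivalently, $A-\sigma I$ is not invertible. $\mathbb{H}^2$ is considered as a right quaternionic vector space. *)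

(* Defs.v *)
From HB Require Import structures.
From mathcomp Require Import all_boot all_order all_algebra.
From mathcomp Require Import reals.
From mathcomp Require Import ring.

Set Implicit Arguments.
Unset Strict Implicit.
Unset Printing Implicit Defensive.

Import Order.TTheory GRing.Theory Num.Theory.
Local Open Scope ring_scope.

(* [Quat a b c d] is the quaternion a + b i + c j + d k. *)
Record quat (R : Type) := Quat { quatr : R; quati : R; quatj : R; quatk : R }.

Definition prod_of_quat (R : Type) (x : quat R) : R * R * R * R :=
  (quatr x, quati x, quatj x, quatk x).

Definition quat_of_prod (R : Type) (t : R * R * R * R) : quat R :=
  let: (a, b, c, d) := t in Quat a b c d.

Lemma prod_of_quatK (R : Type) : cancel (@prod_of_quat R) (@quat_of_prod R).
Proof. by case. Qed.

HB.instance Definition _ (R : eqType) :=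
  Equality.copy (quat R) (can_type (@prod_of_quatK R)).
HB.instance Definition _ (R : choiceType) :=
  Choice.copy (quat R) (can_type (@prod_of_quatK R)).

Definition quat0 (R : zmodType) : quat R := Quat 0 0 0 0.

Definition quat_opp (R : zmodType) (x : quat R) : quat R :=
  Quat (- quatr x) (- quati x) (- quatj x) (- quatk x).

Definition quat_add (R : zmodType) (x y : quat R) : quat R :=
  Quat (quatr x + quatr y) (quati x + quati y)
       (quatj x + quatj y) (quatk x + quatk y).

Lemma quat_addA (R : zmodType) : associative (@quat_add R).
Proof. by move=> x y z; congr Quat; rewrite /= addrA. Qed.

Lemma quat_addC (R : zmodType) : commutative (@quat_add R).
Proof. by move=> x y; congr Quat; rewrite /= addrC. Qed.

Lemma quat_add0l (R : zmodType) : left_id (@quat0 R) (@quat_add R).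
Proof. by case=> a b c d; congr Quat; rewrite /= add0r. Qed.

Lemma quat_addNl (R : zmodType) : left_inverse (@quat0 R) (@quat_opp R) (@quat_add R).
Proof. by move=> x; congr Quat; rewrite /= addNr. Qed.

HB.instance Definition _ (R : zmodType) :=
  GRing.isZmodule.Build (quat R) (@quat_addA R) (@quat_addC R) (@quat_add0l R) (@quat_addNl R).

Definition quat1 (R : comNzRingType) : quat R := Quat 1 0 0 0.

(* Hamilton's product: i^2 = j^2 = k^2 = ijk = -1. *)
Definition quat_mul (R : comNzRingType) (x y : quat R) : quat R :=
  Quat (quatr x * quatr y - quati x * quati y - quatj x * quatj y - quatk x * quatk y)
       (quatr x * quati y + quati x * quatr y + quatj x * quatk y - quatk x * quatj y)
       (quatr x * quatj y - quati x * quatk y + quatj x * quatr y + quatk x * quati y)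
       (quatr x * quatk y + quati x * quatj y - quatj x * quati y + quatk x * quatr y).

Lemma quat_mulA (R : comNzRingType) : associative (@quat_mul R).
Proof.
by case=> [? ? ? ?] [? ? ? ?] [? ? ? ?]; congr Quat; rewrite /=; ring.
Qed.

Lemma quat_mul1l (R : comNzRingType) : left_id (@quat1 R) (@quat_mul R).
Proof. by case=> [? ? ? ?]; congr Quat; rewrite /=; ring. Qed.

Lemma quat_mul1r (R : comNzRingType) : right_id (@quat1 R) (@quat_mul R).
Proof. by case=> [? ? ? ?]; congr Quat; rewrite /=; ring. Qed.

Lemma quat_mulDl (R : comNzRingType) : left_distributive (@quat_mul R) (@quat_add R).
Proof.
by case=> [? ? ? ?] [? ? ? ?] [? ? ? ?]; congr Quat; rewrite /=; ring.
Qed.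

Lemma quat_mulDr (R : comNzRingType) : right_distributive (@quat_mul R) (@quat_add R).
Proof.
by case=> [? ? ? ?] [? ? ? ?] [? ? ? ?]; congr Quat; rewrite /=; ring.
Qed.

Lemma quat1_neq0 (R : comNzRingType) : quat1 R != 0.
Proof. by apply/eqP => -[] /eqP; rewrite oner_eq0. Qed.

HB.instance Definition _ (R : comNzRingType) :=
  GRing.Zmodule_isNzRing.Build (quat R)
    (@quat_mulA R) (@quat_mul1l R) (@quat_mul1r R)
    (@quat_mulDl R) (@quat_mulDr R) (@quat1_neq0 R).

Definition quat_conj (R : zmodType) (x : quat R) : quat R :=
  Quat (quatr x) (- quati x) (- quatj x) (- quatk x).

Definition quat_norm (R : rcfType) (x : quat R) : R :=
  Num.sqrt (quatr x ^+ 2 + quati x ^+ 2 + quatj x ^+ 2 + quatk x ^+ 2).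

Definition conj_trmx (R : zmodType) (m n : nat) (A : 'M[quat R]_(m, n)) :
    'M[quat R]_(n, m) :=
  (map_mx (@quat_conj R) A)^T.

Definition symplectic (R : comNzRingType) (n : nat) (A : 'M[quat R]_n) : Prop :=
  A *m conj_trmx A = 1%:M.

(* Entrywise, (sigma *: v) i j = sigma * v i j: the scaling of matrices over a
   noncommutative ring is by multiplication on the left. *)
Definition left_eigenvalue (R : comNzRingType) (n : nat) (A : 'M[quat R]_n)
    (sigma : quat R) : Prop :=
  exists2 v : 'cV[quat R]_n, v != 0 & A *m v = sigma *: v.

(* Main.v *)
Require Import Defs.
From mathcomp Require Import all_boot all_order all_algebra.
From mathcomp Require Import reals.
From mathcomp Require Import ring lra.

Set Implicit Arguments.
Unset Strict Implicit.
Unset Printing Implicit Defensive.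

Import Order.TTheory GRing.Theory Num.Theory.
Local Open Scope ring_scope.

(** Four points of R^4 always lie on a common affine hyperplane, so there are a
unit quaternion [q] and a real [c] such that every [sigma_m] satisfies
<q, sigma_m> = c ([quat_hyperplane4]).  As <q, x> is the real part of q^* x,
which is a unit quaternion when x is one, we get |c| <= 1, and with
s = sqrt (1 - c^2) the equation says exactly that x = q (c + s w) for some w
with w^2 = -1 ([quat_unit_polar]).

On the other hand, the real rotation with rows (c, s) and (- s, c) followed by
left multiplication by [q] is a symplectic matrix, and the vector (1, w) is an
eigenvector of it for the left eigenvalue q (c + s w) whenever w^2 = -1
([left_eigenvalue_rotation]).  The left spectrum of this one matrix thus
contains the whole intersection of the unit sphere with the hyperplane, hence
the four given quaternions. *)

Definition quat_real (R : zmodType) (a : R) : quat R := Quat a 0 0 0.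

Definition quat_dot (R : nzRingType) (x y : quat R) : R :=
  quatr x * quatr y + quati x * quati y + quatj x * quatj y + quatk x * quatk y.

Lemma quat_realC (R : comNzRingType) (a : R) (x : quat R) :
  x * quat_real a = quat_real a * x.
Proof. by case: x => *; congr Quat; rewrite /=; ring. Qed.

Lemma quat_mul_conj (R : comNzRingType) (x : quat R) :
  x * quat_conj x = quat_real (quat_dot x x).
Proof. by case: x => *; rewrite /quat_dot; congr Quat; rewrite /=; ring. Qed.

Lemma quat_conjM (R : comNzRingType) (x y : quat R) :
  quat_conj (x * y) = quat_conj y * quat_conj x.
Proof. by case: x y => [????] [????]; congr Quat; rewrite /=; ring. Qed.

Lemma quatr_conjM (R : comNzRingType) (x y : quat R) :
  quatr (quat_conj x * y) = quat_dot x y.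
Proof. by case: x y => [????] [????]; rewrite /quat_dot /=; ring. Qed.

Lemma quat_dot_conjM (R : comNzRingType) (x y : quat R) :
  quat_dot (quat_conj x * y) (quat_conj x * y) = quat_dot x x * quat_dot y y.
Proof. by case: x y => [????] [????]; rewrite /quat_dot /=; ring. Qed.

Lemma quat_dot_ge0 (R : realDomainType) (x : quat R) : 0 <= quat_dot x x.
Proof. by rewrite !addr_ge0 // -expr2 sqr_ge0. Qed.

Lemma sqr_quatr_le_dot (R : realDomainType) (x : quat R) :
  quatr x ^+ 2 <= quat_dot x x.
Proof.
by rewrite /quat_dot -!addrA -expr2 lerDl !addr_ge0 // -expr2 sqr_ge0.
Qed.

Lemma quat_dot_eq0 (R : realDomainType) (x : quat R) :
  quat_dot x x = 0 -> x = 0.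
Proof.
case: x => a b c d; rewrite /quat_dot /= -!expr2 => /eqP.
rewrite !paddr_eq0 ?addr_ge0 ?sqr_ge0 // !sqrf_eq0.
by move=> /andP[/andP[/andP[/eqP-> /eqP->] /eqP->] /eqP->].
Qed.

Lemma quat_norm1_dot (R : rcfType) (x : quat R) :
  quat_norm x = 1 -> quat_dot x x = 1.
Proof.
move=> x1; have := quat_dot_ge0 x; rewrite /quat_dot -!expr2 => /sqr_sqrtr <-.
by rewrite -/(quat_norm x) x1 expr1n.
Qed.

(** The imaginary part of [x] is a vector of R^3 of length |s|: dividing it by
[s] gives an imaginary unit.  If s = 0 this part vanishes and any imaginary
unit does. *)
Lemma quat_unit_polar (R : realFieldType) (x : quat R) (s : R) :
    quat_dot x x = 1 -> quatr x ^+ 2 + s ^+ 2 = 1 ->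
  exists2 w : quat R, w * w = -1 & x = quat_real (quatr x) + quat_real s * w.
Proof.
case: x => a b c d; rewrite /quat_dot /= => x1 as1.
have bcd : b ^+ 2 + c ^+ 2 + d ^+ 2 = s ^+ 2 by lra.
have [s0|sN0] := eqVneq s 0.
  have /quat_dot_eq0[-> -> ->] : quat_dot (Quat 0 b c d) (Quat 0 b c d) = 0.
    by rewrite /quat_dot /= -!expr2 expr0n add0r bcd s0 expr0n.
  by exists (Quat 0 1 0 0); congr Quat; rewrite /= ?s0; ring.
exists (Quat 0 (b / s) (c / s) (d / s)); last by congr Quat; rewrite /=; field.
congr Quat; rewrite /=; try by field.
transitivity (- ((b ^+ 2 + c ^+ 2 + d ^+ 2) / s ^+ 2)); first by field.
by rewrite bcd divff // sqrf_eq0.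
Qed.

Definition lmul_rotation (R : comNzRingType) (q : quat R) (c s : R) :
    'M[quat R]_2 :=
  \matrix_(i, j) (q * quat_real
    (if i == j then c else if i == 0 then s else - s)).

Lemma symplectic_lmul_rotation (R : comNzRingType) (q : quat R) (c s : R) :
  quat_dot q q = 1 -> c ^+ 2 + s ^+ 2 = 1 -> symplectic (lmul_rotation q c s).
Proof.
move=> q1 cs1; have entry (a b : R) :
    q * quat_real a * quat_conj (q * quat_real b) = quat_real (a * b).
  have realM : quat_real a * quat_real b = quat_real (a * b).
    by congr Quat; rewrite /=; ring.
  have -> : quat_conj (q * quat_real b) = quat_real b * quat_conj q.
    by rewrite quat_conjM; congr (_ * _); congr Quat; rewrite /= oppr0.
  by rewrite mulrA -(mulrA q) realM quat_realC -mulrA quat_mul_conj q1 mulr1.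
apply/matrixP => i j; rewrite !mxE !big_ord_recl big_ord0 !mxE !entry addr0.
(* The four entries are c^2 + s^2 on the diagonal and c (- s) + s c off it. *)
case: i => [[|[|//]] /= ?]; case: j => [[|[|//]] /= ?];
  congr Quat; rewrite /= -?cs1; ring.
Qed.

(** With q factored out, the second coordinate of the eigenvector equation for
(1, w) reads - s + c w = (c + s w) w, that is s (w^2 + 1) = 0. *)
Lemma left_eigenvalue_rotation (R : comNzRingType) (q w : quat R) (c s : R) :
  w * w = -1 ->
  left_eigenvalue (lmul_rotation q c s) (q * (quat_real c + quat_real s * w)).
Proof.
move=> w2; exists (\col_i (if i == 0 then 1 else w)).
  by apply/eqP => /matrixP /(_ 0 0) /eqP; rewrite !mxE /= oner_eq0.
apply/matrixP => i j; rewrite !mxE !big_ord_recl big_ord0 !mxE addr0.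
case: i => [[|[|//]] /= ?].
  by rewrite !mulr1 -mulrA -mulrDr.
rewrite mulr1 -!mulrA -mulrDr mulrDl -mulrA w2 mulrN1 addrC.
by congr (_ * (_ + _)); congr Quat; rewrite /= ?oppr0.
Qed.

(** The three differences [x_m - x_1] have a common normal vector, since a
4 x 3 matrix has a nontrivial left kernel. *)
Lemma quat_hyperplane4 (R : rcfType) (x1 x2 x3 x4 : quat R) :
  exists q : quat R, [/\ quat_dot q q = 1, quat_dot q x2 = quat_dot q x1,
    quat_dot q x3 = quat_dot q x1 & quat_dot q x4 = quat_dot q x1].
Proof.
pose coord (x : quat R) (i : nat) :=
  [:: quatr x; quati x; quatj x; quatk x]`_i.
pose y (j : nat) := [:: x2 - x1; x3 - x1; x4 - x1]`_j.
pose M : 'M[R]_(4, 3) := \matrix_(i, j) coord (y j) i.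
have : kermx M != 0.
  rewrite -mxrank_eq0 mxrank_ker -lt0n subn_gt0.
  exact: leq_ltn_trans (rank_leq_col M) _.
rewrite -nz_row_eq0 => uN0.
have /sub_kermxP uM := nz_row_sub (kermx M).
move: (nz_row _) uN0 uM => u uN0 uM.
pose p := Quat (u 0 0) (u 0 1) (u 0 2%:R) (u 0 3%:R).
have pN0 : quat_dot p p != 0.
  apply: contra_neq uN0 => /quat_dot_eq0[u0 u1 u2 u3].
  apply/rowP => i; rewrite mxE.
  by case: i => [[|[|[|[|//]]]] ?]; [rewrite -[RHS]u0|rewrite -[RHS]u1
    |rewrite -[RHS]u2|rewrite -[RHS]u3]; congr (u _ _); apply/val_inj.
have pyj (j : 'I_3) : quat_dot p (y j) = 0.
  have /matrixP /(_ 0 j) := uM; rewrite !mxE !big_ord_recl big_ord0 !mxE.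
  rewrite addr0 !addrA => <-; rewrite /quat_dot /p /=.
  by congr (_ * _ + _ * _ + _ * _ + _ * _); congr (u _ _); apply/val_inj.
pose n := Num.sqrt (quat_dot p p).
have n2 : n ^+ 2 = quat_dot p p by rewrite sqr_sqrtr ?quat_dot_ge0.
have nN0 : n != 0 by rewrite -sqrf_eq0 n2.
pose q := quat_real n^-1 * p.
have dotq (x : quat R) : quat_dot q x = n^-1 * quat_dot p x.
  by rewrite /quat_dot /=; ring.
have dotB (x : quat R) : quat_dot p (x - x1) = 0 -> quat_dot q x = quat_dot q x1.
  move=> px; apply/eqP; rewrite -subr_eq0 !dotq -mulrBr.
  suff -> : quat_dot p x - quat_dot p x1 = quat_dot p (x - x1).
    by rewrite px mulr0.
  by rewrite /quat_dot /=; ring.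
exists q; split.
- transitivity (n^-1 ^+ 2 * quat_dot p p); last first.
    by rewrite -n2 exprVn mulVf // sqrf_eq0.
  by rewrite /quat_dot /=; ring.
- exact/dotB/(pyj 0).
- exact/dotB/(pyj 1).
- exact/dotB/(pyj 2%:R).
Qed.

Theorem theorem2p5 (R : realType) (sigma1 sigma2 sigma3 sigma4 : quat R)
    (h1 : quat_norm sigma1 = 1) (h2 : quat_norm sigma2 = 1)
    (h3 : quat_norm sigma3 = 1) (h4 : quat_norm sigma4 = 1) :
  exists A : 'M[quat R]_2,
    symplectic A /\
    [/\ left_eigenvalue A sigma1, left_eigenvalue A sigma2,
        left_eigenvalue A sigma3 & left_eigenvalue A sigma4].
Proof.
have [q [q1 e2 e3 e4]] := quat_hyperplane4 sigma1 sigma2 sigma3 sigma4.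
pose c := quat_dot q sigma1.
have unit_conjM x : quat_norm x = 1 ->
    quat_dot (quat_conj q * x) (quat_conj q * x) = 1.
  by move=> /quat_norm1_dot x1; rewrite quat_dot_conjM q1 x1 mulr1.
have c2_compl_ge0 : 0 <= 1 - c ^+ 2.
  by rewrite subr_ge0 -(unit_conjM _ h1) -[c]quatr_conjM sqr_quatr_le_dot.
pose s := Num.sqrt (1 - c ^+ 2).
have cs1 : c ^+ 2 + s ^+ 2 = 1 by rewrite sqr_sqrtr // addrC subrK.
have eig x : quat_norm x = 1 -> quat_dot q x = c ->
    left_eigenvalue (lmul_rotation q c s) x.
  move=> x1 qx; have [||w w2 xE] := @quat_unit_polar _ (quat_conj q * x) s.
  - exact: unit_conjM.
  - by rewrite quatr_conjM qx.
  have -> : x = q * (quat_real c + quat_real s * w).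
    by rewrite -qx -quatr_conjM -xE mulrA quat_mul_conj q1 mul1r.
  exact: left_eigenvalue_rotation.
exists (lmul_rotation q c s); split; first exact: symplectic_lmul_rotation.
by split; apply: eig.
Qed.
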